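(* Fix any distribution $P$ on $\mathcal{X}\times\mathbb{R}$, any symmetric regression algorithm $\mathcal{A}$, any sample size $n\geq 1$, and any inflation parameter $\gamma>0$. Then for any $m\geq 1$ and any $\delta\in(0,1)$, \[\mathbb{P}\left\{ \alpha_P^{\gamma\text{-J+}}(\mathcal{D}_n) < \alpha + 3\sqrt{\frac{\log(1/\delta)}{2\min\{n,m\}}} + 2\sqrt[3]{\frac{2\beta_{m,n-1}^{\mathrm{out}}(\mathcal{A},P)}{\gamma}} \right\} \geq 1 - 3\delta - \sqrt[3]{\frac{2\beta_{m,n-1}^{\mathrm{out}}(\mathcal{A},P)}{\gamma}},\] where the probability is taken with respect to $\mathcal{D}_n = \{(X_i,Y_i)\}_{i\in[n]}$ drawn i.i.d. from $P$.
   Context: Write $[n]=\{1,\dots,n\}$. Let $\mathcal{X}$ be a measurable space. A regression algorithm is a map $\mathcal{A}:\bigcup_{n\geq 0}(\mathcal{X}\times\mathbb{R})^n\to\{\text{measurable functions }\mathcal{X}\to\mathbb{R}\}$. It is symmetric if for each $n\ge1$, each data set and each permutation $\pi$ of $[n]$, $\mathcal{A}((X_1,Y_1),\dots,(X_n,Y_n))=\mathcal{A}((X_{\pi(1)},Y_{\pi(1)}),\dots,(X_{\pi(n)},Y_{\pi(n)}))$. All quantities whose probabilities or expectations are taken are understood to be measurable. A target level $\alpha\in(0,1)$ is fixed. Quantile: for real $v_1,\dots,v_n$ and $\tau\in\mathbb{R}$, $\mathrm{Quantile}(\{v_i\}_{i\in[n]};\tau)=\inf\{t\in\mathbb{R}: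 \#\{i\in[n]: v_i\le t\}\ge \tau n\}$, equal to $+\infty$ if $\tau>1$. Inflated jackknife+: given $\mathcal{D}_n=\{(X_i,Y_i)\}_{i\in[n]}$, let $\widehat\mu_{-i}=\mathcal{A}(\{(X_j,Y_j)\}_{j\in[n]\setminus\{i\}})$ and $R_i=|Y_i-\widehat\mu_{-i}(X_i)|$ for $i\in[n]$. For $\gamma\ge 0$, the $\gamma$-inflated jackknife+ interval at $x$ is \[\widehat{C}^{\gamma\text{-J+}}_n(x)=\Big[-\mathrm{Quantile}\big(\{-\widehat\mu_{-i}(x)+R_i\}_{i\in[n]};(1-\alpha)(1+1/n)\big)-\gamma,\ \mathrm{Quantile}\big(\{\widehat\mu_{-i}(x)+R_i\}_{i\in[n]};(1-\alpha)(1+1/n)\big)+\gamma\Big]\] (as a subset of $\mathbb{R}$, empty if the lower endpoint exceeds the upper). Its training-conditional miscoverage rate is $\alpha_P^{\gamma\text{-J+}}(\mathcal{D}_n)=\mathbb{P}\{Y_{n+1}\notin\widehat{C}^{\gamma\text{-J+}}_n(X_{n+1})\mid\mathcal{D}_n\}$, where $(X_{n+1},Y_{n+1})\sim P$ is independent of $\mathcal{D}_n$. Out-of-sample $m$-stability: for $n,m\ge0$, $\beta^{\mathrm{out}}_{m,n}(\mathcal{A},P)=\mathbb{E}[|\widehat\mu_n(X)-\widehat\mu_{n+m}(X)|]$, where $\widehat\mu_k=\mathcal{A}((X_1,Y_1),\dots,(X_k,Y_k))$ and $(X_1,Y_1),\dots,(X_{n+m},Y_{n+m}),(X,Y)$ are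 i.i.d. from $P$. *)

(* Defs.v *)
From HB Require Import structures.
From mathcomp Require Import all_boot all_order all_algebra all_fingroup.
From mathcomp Require Import all_classical all_reals all_analysis.

Set Implicit Arguments.
Unset Strict Implicit.
Unset Printing Implicit Defensive.

Import Order.TTheory GRing.Theory Num.Theory.
Import numFieldNormedType.Exports.

Local Open Scope classical_set_scope.
Local Open Scope ring_scope.

Section iid_sample.
Context d (Z : measurableType d) (R : realType).

Definition cons_pair n (w : Z * n.-tuple Z) : n.+1.-tuple Z :=
  [tuple of w.1 :: w.2].

Lemma measurable_cons_pair n : measurable_fun [set: _] (@cons_pair n).
Proof. exact: measurable_cons. Qed.

HB.instance Definition _ n :=
  isMeasurableFun.Build _ _ _ _ (@cons_pair n) (@measurable_cons_pair n).

(* The law of an i.i.d. sample of size n from P (the n-fold product measure),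
   see iid_law_box. *)
Fixpoint iid_law (P : probability Z R) (n : nat) :
    probability (n.-tuple Z) R :=
  match n with
  | 0 => \d_([tuple] : 0.-tuple Z)
  | n'.+1 => distribution (P \x iid_law P n')%E (@cons_pair n')
  end.

Lemma measurable_box n (B : 'I_n -> set Z) :
  (forall i, measurable (B i)) ->
  measurable [set D : n.-tuple Z | forall i, B i (tnth D i)].
Proof.
move=> mB; rewrite [X in measurable X](_ : _ =
    \bigcap_(i in [set: 'I_n]) ((@tnth n Z)^~ i @^-1` B i)); last first.
  by apply/seteqP; split => [D DB i _|D DB i]; [exact: DB|exact: (DB i I)].
apply: fin_bigcap_measurable => // i _; rewrite -[X in measurable X]setTI.
exact: measurable_tnth.
Qed.

Lemma iid_law_box (P : probability Z R) n (B : 'I_n -> set Z) :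
  (forall i, measurable (B i)) ->
  iid_law P n [set D | forall i, B i (tnth D i)] = (\prod_(i < n) P (B i))%E.
Proof.
elim: n B => [|n IH] B mB.
  rewrite big_ord0 /= diracE mem_set//.
  by case.
rewrite big_ord_recl -(IH (B \o lift ord0)); last by move=> i; exact: mB.
rewrite -product_measure1E//; last by apply: measurable_box => i; exact: mB.
rewrite /= /distribution /pushforward; congr (_ _).
apply/seteqP; split => [[z D] /= zD|[z D] /= [zB DB] i].
  split; first by have := zD ord0; rewrite /cons_pair tnth0.
  by move=> i; have := zD (lift ord0 i); rewrite /cons_pair tnthS.
by case: (unliftP ord0 i) => [j|] ->; rewrite /cons_pair ?tnthS ?tnth0.
Qed.

End iid_sample.

Section jackknife.
Context d (X : measurableType d) (R : realType).

(* A data set of any finite size is a sequence of pairs (x, y). *)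
Definition regression_algorithm := seq (X * R) -> {mfun X >-> R}.

Definition symmetric_algorithm (A : regression_algorithm) :=
  forall n (D : n.-tuple (X * R)) (s : 'S_n),
    (1 <= n)%N -> A D = A [tuple tnth D (s i) | i < n].

(* The fitted value at x, for training sets of each given size, is jointly
   measurable in the training set and x. *)
Definition measurable_algorithm (A : regression_algorithm) :=
  forall n, measurable_fun [set: n.-tuple (X * R) * X]
    (fun w : n.-tuple (X * R) * X => A w.1 w.2).

(* For n >= 1 and tau > 1 the set is empty and its infimum is +oo. *)
Definition quantile n (v : 'I_n -> R) (tau : R) : \bar R :=
  ereal_inf (EFin @`
    [set t : R | tau * n%:R <= #|[pred i | v i <= t]|%:R]).

Section interval.
Variables (A : regression_algorithm) (alpha gamma : R).
Variables (n : nat) (D : n.-tuple (X * R)).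

Definition loo_fit (i : 'I_n) : {mfun X >-> R} := A (take i D ++ drop i.+1 D).

Definition loo_residual (i : 'I_n) : R :=
  `| (tnth D i).2 - loo_fit i (tnth D i).1 |.

Definition jplus_level : R := (1 - alpha) * (1 + n%:R^-1).

Definition jplus_lower (x : X) : \bar R :=
  (- quantile (fun i => - loo_fit i x + loo_residual i)%R jplus_level
   - gamma%:E)%E.

Definition jplus_upper (x : X) : \bar R :=
  (quantile (fun i => loo_fit i x + loo_residual i)%R jplus_level
   + gamma%:E)%E.

Definition jplus_interval (x : X) : set R :=
  [set y | (jplus_lower x <= y%:E)%E /\ (y%:E <= jplus_upper x)%E].

(* Since the test point is independent of the training sample, conditioning
   on the training sample amounts to fixing D. *)
Definition jplus_miscoverage (P : probability (X * R)%type R) : \bar R :=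
  P [set z : X * R | ~ jplus_interval z.1 z.2].

End interval.

(* The sample of size n + m and the independent test point (X, Y) have joint
   law iid_law P (n + m) \x P; the expectation lives in \bar R, so it may
   be +oo. *)
Definition beta_out (A : regression_algorithm) (P : probability (X * R)%type R)
    (m n : nat) : \bar R :=
  ('E_(iid_law P (n + m) \x P)
     [fun w : (n + m).-tuple (X * R) * (X * R) =>
        (`| A (take n w.1) w.2.1 - A w.1 w.2.1 |)%R])%E.

End jackknife.

(* Main.v *)
Require Import Defs.
From HB Require Import structures.
From mathcomp Require Import all_boot all_order all_algebra all_fingroup.
From mathcomp Require Import all_classical all_reals all_analysis.
From mathcomp Require Import measurable_realfun ring lra.

Set Implicit Arguments.
Unset Strict Implicit.
Unset Printing Implicit Defensive.
Import Order.TTheory GRing.Theory Num.Theory.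
Import numFieldNormedType.Exports.

Local Open Scope ring_scope.

(** Let b be the stability coefficient beta_out A P m (n - 1), let c be the
cube root of 2 b / gamma, and let e be the square root that appears in the
bound, so that exp (- 2 k e^2) <= delta for k = n and for k = m.

The miscoverage rate of the fixed sample D is compared with the fraction of
miscovered points among m fresh test points D'. Then D and D' together are a
pool V of n + m exchangeable points, and each point k of the pool gets the
residual r_k of the model fitted on the whole pool without k. These pool
residuals stand in for the jackknife+ quantities. The fit without i on D uses
n - 1 points and the fit without k on V uses n - 1 + m points, so at a point k
that neither of them has seen they differ by b on average
([expected_loo_gap]). If for a pair (i, j) of a training and a test point the
gap at i and the gap at j add up to at most gamma, then the inflation by gamma
absorbs them: a test point that lies beyond the i-th inflated bound has
r_i < r_j ([stable_pair_residual]).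

Four events may go wrong.
- The fraction of miscovered test points is smaller than the miscoverage rate
  by e or more. Given D the test points are independent, so Hoeffding's
  inequality bounds the probability by delta ([hoeffding_conditional]).
- More than a fraction c^2 of the pairs (i, j) has gaps that add up to more
  than gamma. By Markov's inequality a given pair does so with probability at
  most 2 b / gamma = c^3, and once more by Markov's inequality the event has
  probability at most c ([unstable_pairs_prob]).
- More than a fraction alpha + c + 2 e of the test points has a residual that
  at most a fraction alpha + c of the training residuals reaches. Given the
  values of the pool residuals, exchangeability makes the split into training
  and test points uniformly random, so this is a statement on sampling without
  replacement: compare the test points, and also the training points, with the
  whole pool at its quantile of level alpha + c + e. Each comparison fails with
  probability at most delta ([rank_exceeders_le]).

Otherwise all but a fraction c of the test points are in few (at most c n) bad
pairs. A miscovered one among them has a residual larger than at least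
(1 - alpha - c) n training residuals, so there are at most (alpha + c + 2 e) m
of those ([card_miscovered_tests]). Hence the miscoverage rate is less than
alpha + 2 c + 3 e. *)

(** * The moment generating function of a Bernoulli variable *)

Section bernoulli_mgf.
Variable R : realType.
Implicit Types p l x : R.

Let D p l : R := 1 - p + p * expR l.

Let D_gt0 p l : 0 <= p <= 1 -> 0 < D p l.
Proof.
move=> /andP[p0 p1]; rewrite /D.
have [->|pn1] := eqVneq p 1; first by rewrite subrr add0r mul1r expR_gt0.
by rewrite ltr_pwDl ?mulr_ge0 ?expR_ge0// subr_gt0 lt_neqAle pn1.
Qed.

(** The Bernoulli law tilted by exp (l x) has mean
u = p exp l / (1 - p + p exp l), and du/dl = u (1 - u) <= 1/4. *)
Lemma tilted_bernoulli_mean_le p l : 0 <= p <= 1 -> 0 <= l ->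
  p * expR l <= (p + l / 4) * (1 - p + p * expR l).
Proof.
move=> p01 l0.
pose f x : R := p * expR x / D p x - x / 4 - p.
pose f' x : R := - (p * expR x / D p x - 1 / 2) ^+ 2.
have df x : is_derive x 1 f (f' x).
  have D0 : D p x != 0 by rewrite gt_eqF ?D_gt0.
  rewrite /f /D; apply: is_derive_eq.
  rewrite /f' /D /GRing.scale/=.
  field. exact: D0.
have : f l <= f 0.
  apply: (@ler0_derive1_nincry _ f 0) => //.
  - move=> x _; rewrite derive1E (@derive_val _ _ _ _ _ _ _ (df x)).
    by rewrite oppr_le0 sqr_ge0.
  - by apply: derivable_within_continuous => x _; case: (df x).
rewrite /f {2}/D expR0 !mulr1 subrK divr1 mul0r subr0 subrr.
by rewrite -addrA -opprD subr_le0 ler_pdivrMr ?D_gt0// (addrC (l / 4)).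
Qed.

(** Hoeffding's lemma: the quotient of the two sides is 1 at l = 0 and
decreases, because its logarithmic derivative is the tilted mean minus
p + l / 4. *)
Lemma bernoulli_mgf_le p l : 0 <= p <= 1 -> 0 <= l ->
  1 - p + p * expR l <= expR (l * p + l ^+ 2 / 8).
Proof.
move=> p01 l0.
pose g x : R := D p x * expR (- (x * p + x ^+ 2 / 8)).
pose g' x : R := (p * expR x - (p + x / 4) * D p x) *
  expR (- (x * p + x ^+ 2 / 8)).
have dg x : is_derive x 1 g (g' x).
  rewrite /g /D; apply: is_derive_eq.
  rewrite /g' /D /GRing.scale/=.
  by field.
have : g l <= g 0.
  apply: (@ler0_derive1_nincry _ g 0) => //.
  - move=> x; rewrite in_itv/= andbT => /ltW x0.
    rewrite derive1E (@derive_val _ _ _ _ _ _ _ (dg x)) /g'.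
    rewrite mulr_le0_ge0 ?expR_ge0// subr_le0.
    exact: tilted_bernoulli_mean_le.
  - by apply: derivable_within_continuous => x _; case: (dg x).
rewrite /g {2}/D !expR0 mul0r expr0n/= mul0r addr0 oppr0 expR0 !mulr1 subrK.
by rewrite expRN ler_pdivrMr ?expR_gt0// mul1r.
Qed.

End bernoulli_mgf.

(** * Sampling without replacement *)

Section permutation_sampling.
Variables (R : realType) (T : finType).
Implicit Types (a : T -> R) (B I : {set T}) (s : {perm T}).

Let perm_sum a I := \sum_(s : {perm T}) \prod_(k in I) a (s k).

Let perm_sum_reindex (t : {perm T}) (F : {perm T} -> R) :
  \sum_s F (t * s)%g = \sum_(s : {perm T}) F s.
Proof.
by rewrite [RHS](reindex_inj (mulgI t)).
Qed.

Let card_perms : #|{perm T}| = (#|T|)`!.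
Proof.
rewrite (eq_card (B := perm_on [set: T])); first by rewrite card_perm cardsT.
move=> s; rewrite inE unfold_in /perm_on /=.
by apply/esym/fintype.subsetP => i _; rewrite inE.
Qed.

(** Expand the sum of all a k as a sum over positions k of a (s k). A position
k outside l |: I may be exchanged with l. For a position k of I the value is
used twice, and a product of two values is on average at most a square. *)
Lemma perm_sum_prod_step a I l : (forall k, 0 <= a k) -> l \notin I ->
  #|T|%:R * perm_sum a (l |: I) <= (\sum_k a k) * perm_sum a I.
Proof.
move=> a0 lI.
have prodU s : \prod_(k in l |: I) a (s k) = a (s l) * \prod_(k in I) a (s k).
  by rewrite big_setU1.
have -> : (\sum_k a k) * perm_sum a I =
    \sum_(k : T) \sum_(s : {perm T}) a (s k) * \prod_(i in I) a (s i).
  rewrite /perm_sum exchange_big/= mulr_sumr; apply: eq_bigr => /= s _.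
  rewrite -mulr_suml; congr (_ * _).
  by rewrite (reindex_inj (@perm_inj _ s)).
have -> : #|T|%:R * perm_sum a (l |: I) = \sum_(k : T) perm_sum a (l |: I).
  by rewrite sumr_const mulr_natl.
apply: ler_sum => k _; rewrite /perm_sum (eq_bigr _ (fun s _ => prodU s)).
have [kI|kI] := boolP (k \in I); last first.
  rewrite -(perm_sum_reindex (tperm k l)); apply: ler_sum => s _.
  rewrite permM tpermR (eq_bigr (fun i => a (s i)))// => i iI.
  rewrite permM tpermD//; apply: contraNneq lI.
    by move=> ki; rewrite ki iI in kI.
  by move=> ->.
(* The swap of k and l makes the difference a half-sum of squares. *)
pose c s := \prod_(i in I :\ k) a (s i).
have cE s : \prod_(i in I) a (s i) = a (s k) * c s by rewrite (big_setD1 k).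
have cswap s : c (tperm k l * s)%g = c s.
  apply: eq_bigr => i; rewrite !inE => /andP[ik iI].
  rewrite permM tpermD//; first by rewrite eq_sym.
  by apply: contraNneq lI => ->.
have Ek : \sum_(s : {perm T}) a (s k) * \prod_(i in I) a (s i) =
    \sum_(s : {perm T}) a (s k) ^+ 2 * c s.
  by apply: eq_bigr => s _; rewrite cE mulrA expr2.
have Ekl : \sum_(s : {perm T}) a (s k) ^+ 2 * c s =
    \sum_(s : {perm T}) a (s l) ^+ 2 * c s.
  rewrite -(perm_sum_reindex (tperm k l)); apply: eq_bigr => s _.
  by rewrite cswap permM tpermL.
have El : \sum_(s : {perm T}) a (s l) * \prod_(i in I) a (s i) =
    \sum_(s : {perm T}) a (s l) * a (s k) * c s.
  by apply: eq_bigr => s _; rewrite cE mulrA.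
rewrite Ek El -(ler_pM2l (ltr0n R 2)) [leRHS]mulr_natl [leRHS]mulr2n.
rewrite {2}Ekl -big_split.
rewrite mulr_sumr; apply: ler_sum => s _ /=.
have : 0 <= (a (s k) - a (s l)) ^+ 2 * c s.
  by rewrite mulr_ge0 ?sqr_ge0// prodr_ge0.
by lra.
Qed.

(** A product of values drawn without replacement has at most the mean that
independent draws would give it. *)
Lemma perm_sum_prod_le a I : (forall k, 0 <= a k) ->
  perm_sum a I <= (#|T|)`!%:R * ((\sum_k a k) / #|T|%:R) ^+ #|I|.
Proof.
move=> a0; have [n] := ubnP #|I|; elim: n I => // n IH I.
have [->|[l lI]] := set_0Vmem I.
  rewrite /perm_sum cards0 expr0 mulr1 => _.
  under eq_bigr do rewrite big_set0.
  by rewrite sumr_const card_perms.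
rewrite (cardsD1 l) lI add1n ltnS => /IH {}IH.
have T0 : 0 < #|T|%:R :> R by rewrite ltr0n; apply/card_gt0P; exists l.
rewrite exprS mulrCA -(ler_pM2l T0) [leRHS]mulrA [_ * (_ / _)]mulrC.
rewrite divfK ?gt_eqF//.
have lI' : l \notin I :\ l by rewrite !inE eqxx.
have := perm_sum_prod_step a0 lI'; rewrite finset.setD1K// => /le_trans; apply.
by rewrite ler_wpM2l ?sumr_ge0.
Qed.

(** Chernoff's method works as for independent draws, since
[perm_sum_prod_le] bounds the moment generating function by the independent
one. *)
Lemma hoeffding_without_replacement B I (e : R) : 0 <= e ->
  #|[set s : {perm T} | #|I|%:R * (#|B|%:R / #|T|%:R + e) <=
                        #|[set k in I | s k \in B]|%:R]|%:R
  <= (#|T|)`!%:R * expR (- (2 * #|I|%:R * e ^+ 2)) :> R.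
Proof.
move=> e0; set p := #|B|%:R / _.
have p01 : 0 <= p <= 1.
  rewrite /p divr_ge0//=; have [->|T0] := posnP #|T|.
    by rewrite invr0 mulr0.
  by rewrite ler_pdivrMr ?ltr0n// mul1r ler_nat max_card.
(* This l minimises l^2 / 8 - l e. *)
pose l := 4 * e; have l0 : 0 <= l by rewrite mulr_ge0.
pose a k := expR (l * (k \in B)%:R); have a0 k : 0 <= a k by exact: expR_ge0.
have a_mean : (\sum_k a k) / #|T|%:R <= expR (l * p + l ^+ 2 / 8).
  have [T0|T0] := posnP #|T|; first by rewrite T0 invr0 mulr0 expR_ge0.
  have T0' : #|T|%:R != 0 :> R by rewrite pnatr_eq0 -lt0n.
  apply: le_trans (bernoulli_mgf_le p01 l0); rewrite le_eqVlt; apply/orP; left.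
  have aE k : a k = 1 + (k \in B)%:R * (expR l - 1).
    rewrite /a; case: (k \in B); first by rewrite mulr1 mul1r addrC subrK.
    by rewrite mulr0 mul0r expR0 addr0.
  rewrite (eq_bigr _ (fun k _ => aE k)) big_split/= sumr_const -mulr_suml.
  have -> : \sum_k (k \in B)%:R = #|B|%:R :> R.
    by rewrite -natr_sum -big_mkcond/= sum1_card.
  rewrite /p; apply/eqP; field; exact: T0'.
have chernoff s : (#|I|%:R * (p + e) <= #|[set k in I | s k \in B]|%:R)%R%:R <=
    expR (- (l * (#|I|%:R * (p + e)))) * \prod_(k in I) a (s k) :> R.
  rewrite -expR_sum -expRD -mulr_sumr -natr_sum.
  rewrite -big_mkcondr/= sum1_card.
  have -> : #|[pred k | (k \in I) && (s k \in B)]| =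
      #|[set k in I | s k \in B]|.
    by apply: eq_card => k; rewrite !inE.
  have [h|_] := boolP (_ <= #|_|%:R); last by rewrite expR_ge0.
  by rewrite -[leLHS]expR0 ler_expR addrC -mulrBr mulr_ge0// subr_ge0.
rewrite -sum1_card natr_sum big_mkcond/=.
apply: le_trans (_ : \sum_(s : {perm T}) expR (- (l * (#|I|%:R * (p + e)))) *
    \prod_(k in I) a (s k) <= _).
  by apply: ler_sum => s _; move: (chernoff s); rewrite inE; case: ifP.
rewrite -mulr_sumr.
apply: le_trans (ler_wpM2l (expR_ge0 _) (perm_sum_prod_le I a0)) _.
rewrite mulrCA ler_wpM2l//.
have : ((\sum_k a k) / #|T|%:R) ^+ #|I| <= expR (l * p + l ^+ 2 / 8) ^+ #|I|.
  by rewrite lerXn2r// ?nnegrE ?expR_ge0// divr_ge0// sumr_ge0.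
move=> /(ler_wpM2l (expR_ge0 (- (l * (#|I|%:R * (p + e)))))) /le_trans; apply.
rewrite -expRM_natl -expRD ler_expR /l -mulr_natl; lra.
Qed.

End permutation_sampling.

(** * Ranks in a random split *)

Section rank_exceedance.
Variables (R : realType) (T : finType).
Implicit Types (r : T -> R) (I J : {set T}) (s : {perm T}).

Definition rank_exceeders r I J (theta : R) : {set T} :=
  [set j in J | #|[set i in I | r j <= r i]|%:R <= theta * #|I|%:R].

Definition top_ranked r (c : R) : {set T} :=
  [set k | #|[set l | r k <= r l]|%:R <= c].

Definition bottom_ranked r (c : R) : {set T} :=
  [set k | c < #|[set l | r k < r l]|%:R].

Let natr_le_set (A B : {set T}) : A \subset B -> #|A|%:R <= #|B|%:R :> R.
Proof. by move=> AB; rewrite ler_nat subset_leq_card. Qed.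

(** All of them lie above the lowest one, and at most c points do so. *)
Lemma card_top_ranked r (c : R) : 0 <= c -> #|top_ranked r c|%:R <= c.
Proof.
move=> c0; have [->|[k ktop]] := set_0Vmem (top_ranked r c).
  by rewrite cards0.
have [k0 k0top k0min] := @arg_minP _ _ _ _ (mem (top_ranked r c)) r ktop.
apply: le_trans (_ : #|[set l | r k0 <= r l]|%:R <= _); last first.
  have : k0 \in top_ranked r c := k0top.
  by rewrite inE.
by apply/natr_le_set/fintype.subsetP => l ltop; rewrite inE k0min.
Qed.

(** More than c points lie strictly above the highest of them, and none of these
is bottom ranked. *)
Lemma card_bottom_ranked r (c : R) : bottom_ranked r c != finset.set0 ->
  #|bottom_ranked r c|%:R < #|T|%:R - c.
Proof.
case/set0Pn => k klow.
have [k0 k0low k0max] :=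
  @arg_maxP _ _ _ _ (mem (bottom_ranked r c)) r klow.
have : k0 \in bottom_ranked r c := k0low.
rewrite inE => c_lt.
have : #|[set l | r k0 < r l]|%:R <= #|~: bottom_ranked r c|%:R :> R.
  apply/natr_le_set/fintype.subsetP => l; rewrite finset.in_setC inE.
  by apply: contraL => /k0max; rewrite -leNgt.
have : #|bottom_ranked r c|%:R + #|~: bottom_ranked r c|%:R = #|T|%:R :> R.
  by rewrite -natrD cardsC.
lra.
Qed.

(** If all exceeders are top ranked, then J has many top ranked points.
Otherwise some exceeder is not; every point of I that is not bottom ranked
reaches it, so that at most a fraction theta of I is not bottom ranked. *)
Lemma many_rank_exceeders r I J (theta e : R) s : 0 <= theta -> 0 <= e ->
  (theta + 2 * e) * #|J|%:R < #|rank_exceeders (r \o s) I J theta|%:R ->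
  let q := (theta + e) * #|T|%:R in
  #|I|%:R * (#|bottom_ranked r q|%:R / #|T|%:R + e) <=
    #|[set i in I | s i \in bottom_ranked r q]|%:R \/
  #|J|%:R * (#|top_ranked r q|%:R / #|T|%:R + e) <=
    #|[set j in J | s j \in top_ranked r q]|%:R.
Proof.
move=> theta0 e0 large q.
set S := rank_exceeders _ _ _ _ in large.
have SJ : #|S|%:R <= #|J|%:R :> R.
  by apply: natr_le_set; apply/fintype.subsetP => j; rewrite inE => /andP[].
have J0 : 0 <= #|J|%:R :> R by [].
have I0 : 0 <= #|I|%:R :> R by [].
have Spos : 0 < #|S|%:R :> R by apply: le_lt_trans large; nra.
have theta1 : theta + 2 * e < 1.
  by rewrite -(ltr_pM2r (lt_le_trans Spos SJ)) mul1r; exact: lt_le_trans SJ.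
have T0 : 0 < #|T|%:R :> R.
  by apply: lt_le_trans Spos _; rewrite ler_nat max_card.
have frac_le (A : {set T}) (c : R) :
    #|A|%:R <= c * #|T|%:R -> #|A|%:R / #|T|%:R <= c.
  by rewrite ler_pdivrMr.
have q0 : 0 <= q by rewrite /q; nra.
have [topS|] := boolP (S \subset [set j in J | s j \in top_ranked r q]).
  right; apply: le_trans (natr_le_set topS); apply: le_trans (ltW large).
  by have := frac_le _ _ (card_top_ranked r q0); nra.
case/subsetPn => j; rewrite !inE => /andP[jJ jS]; rewrite jJ/= -ltNge => jtop.
left; set low := bottom_ranked r q.
have I_nlow : #|[set i in I | s i \notin low]|%:R <= theta * #|I|%:R.
  apply: le_trans jS; apply/natr_le_set/fintype.subsetP => i.
  rewrite !inE => /andP[-> /=]; apply: contraNT; rewrite -ltNge => rij.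
  apply: lt_le_trans jtop _; apply/natr_le_set/fintype.subsetP => l.
  by rewrite !inE; exact: lt_le_trans.
have Isplit : #|[set i in I | s i \in low]|%:R +
    #|[set i in I | s i \notin low]|%:R = #|I|%:R :> R.
  rewrite -natrD -(cardsID [set i | s i \in low] I).
  by congr (_ + _)%:R; apply: eq_card => i; rewrite !inE// andbC.
have [low0|/card_bottom_ranked] := eqVneq low finset.set0.
  have : #|[set i in I | s i \in low]|%:R = 0 :> R.
    by rewrite low0 (eq_card0)// => i; rewrite !inE andbF.
  move=> I_low; rewrite I_low low0 cards0; move: I_nlow Isplit; rewrite I_low.
  by nra.
rewrite -/low => low_lt.
have : #|low|%:R / #|T|%:R <= 1 - (theta + e).
  by apply: frac_le; move: low_lt; rewrite /q; lra.
nra.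
Qed.

(** The sets of top ranked and of bottom ranked points do not depend on the
split, so Hoeffding's inequality applies to each of them; the threshold
e above theta leaves a deviation e to both. *)
Lemma rank_exceeders_le r I J (theta e : R) : 0 <= theta -> 0 <= e ->
  #|[set s : {perm T} | (theta + 2 * e) * #|J|%:R <
                        #|rank_exceeders (r \o s) I J theta|%:R]|%:R
  <= (#|T|)`!%:R * (expR (- (2 * #|I|%:R * e ^+ 2)) +
                    expR (- (2 * #|J|%:R * e ^+ 2))) :> R.
Proof.
move=> theta0 e0; rewrite mulrDr; set q := (theta + e) * #|T|%:R.
apply: le_trans (lerD (hoeffding_without_replacement (bottom_ranked r q) I e0)
                      (hoeffding_without_replacement (top_ranked r q) J e0)).
rewrite -natrD ler_nat -cardsUI; apply: leq_trans (leq_addr _ _).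
apply/subset_leq_card/fintype.subsetP => s; rewrite !inE => large.
by apply/orP; exact: many_rank_exceeders.
Qed.

End rank_exceedance.

Local Open Scope classical_set_scope.
Local Open Scope ring_scope.

(** * Laws of i.i.d. samples *)

Section iid_law_theory.
Context d (Z : measurableType d) (R : realType).
Variable P : probability Z R.

Definition box n (B : 'I_n -> set Z) : set (n.-tuple Z) :=
  [set D | forall i, B i (tnth D i)].

(** Boxes are a pi-system of generators, which makes [iid_law_box] a
characterisation of the law. *)
Lemma measurable_tupleE n : measurable =
  <<s [set box B | B in
         [set B : 'I_n -> set Z | forall i, measurable (B i)]] >>.
Proof.
apply/seteqP; split; last first.
  apply: smallest_sub; first exact: sigma_algebra_measurable.
  by move=> _ [B mB <-]; exact: measurable_box.
apply: smallest_sub; first exact: smallest_sigma_algebra.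
move=> A /=; rewrite -bigcup_seq => -[i _ [B mB <-]].
apply: sub_sigma_algebra; exists (fun j => if j == i then B else setT).
  by move=> j; case: ifP.
rewrite setTI; apply/seteqP; split => D /=; rewrite /box/=.
  by move=> /(_ i); rewrite eqxx.
by move=> BD j; case: eqP => // ->.
Qed.

Lemma iid_law_boxE n (B : 'I_n -> set Z) : (forall i, measurable (B i)) ->
  iid_law P n (box B) = (\prod_(i < n) P (B i))%E.
Proof. exact: iid_law_box. Qed.

Lemma iid_law_unique n (mu : {measure set (n.-tuple Z) -> \bar R}) :
  (forall B, (forall i, measurable (B i)) ->
    mu (box B) = (\prod_(i < n) P (B i))%E) ->
  forall A, measurable A -> mu A = iid_law P n A.
Proof.
move=> muE.
have boxT : box (fun _ : 'I_n => setT) = setT by apply/seteqP; split.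
have muT : mu setT = 1%E.
  by rewrite -boxT muE// big1// => i _; rewrite probability_setT.
apply: (measure_unique _ (fun _ => setT) (measurable_tupleE n)).
- move=> _ _ [B mB <-] [C mC <-]; exists (fun i => B i `&` C i).
    by move=> i; exact: measurableI.
  apply/seteqP; split => D /=; rewrite /box/=.
    by move=> BC; split => i; case: (BC i).
  by move=> [DB DC] i; split.
- by move=> _; exists (fun _ => setT).
- by apply/seteqP; split => // x _; exists 0%N.
- by move=> _ [B mB <-]; rewrite muE//; exact/esym/iid_law_boxE.
- by move=> _; rewrite muT ltry.
Qed.

Lemma iid_law_preimage d' (S : measurableType d') (Q : probability S R) n
    (f : S -> n.-tuple Z) : measurable_fun setT f ->
  (forall B, (forall i, measurable (B i)) ->
    Q (f @^-1` box B) = (\prod_(i < n) P (B i))%E) ->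
  forall A, measurable A -> Q (f @^-1` A) = iid_law P n A.
Proof.
move=> mf QE A mA.
pose mf' := isMeasurableFun.Build _ _ _ _ f mf.
pose F : {mfun S >-> n.-tuple Z} := HB.pack f mf'.
by rewrite -(@iid_law_unique n (distribution Q F)).
Qed.

Definition perm_sample n (s : {perm 'I_n}) (D : n.-tuple Z) : n.-tuple Z :=
  [tuple tnth D (s i) | i < n].

Lemma measurable_perm_sample n (s : {perm 'I_n}) :
  measurable_fun setT (perm_sample s).
Proof.
apply/measurable_fun_tnthP => i.
rewrite (_ : _ \o _ = (@tnth n Z)^~ (s i)); first exact: measurable_tnth.
by apply/funext => D /=; rewrite tnth_mktuple.
Qed.

HB.instance Definition _ n (s : {perm 'I_n}) :=
  isMeasurableFun.Build _ _ _ _ (perm_sample s) (measurable_perm_sample s).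

Lemma iid_law_exchangeable n (s : {perm 'I_n}) (A : set (n.-tuple Z)) :
  measurable A -> iid_law P n (perm_sample s @^-1` A) = iid_law P n A.
Proof.
move=> mA; apply: iid_law_preimage => //.
move=> B mB; rewrite (_ : _ @^-1` _ = box (fun i => B (s^-1 i)%g)).
  rewrite iid_law_boxE//.
  exact/esym/(reindex_inj (@perm_inj _ s^-1%g)).
apply/seteqP; split => D /=; rewrite /box/= => DB i.
  by have := DB (s^-1 i)%g; rewrite tnth_mktuple permKV.
by rewrite tnth_mktuple; have := DB (s i); rewrite permK.
Qed.

Definition cat_samples n m (w : n.-tuple Z * m.-tuple Z) : (n + m).-tuple Z :=
  [tuple of w.1 ++ w.2].

Lemma measurable_cat_samples n m : measurable_fun setT (@cat_samples n m).
Proof.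
apply/measurable_fun_tnthP => i; case: (fintype.split_ordP i) => j ->.
  rewrite (_ : _ \o _ = (@tnth n Z)^~ j \o fst).
    by apply: measurableT_comp => //; exact: measurable_tnth.
  by apply/funext => -[D D'] /=; rewrite tnth_lshift.
rewrite (_ : _ \o _ = (@tnth m Z)^~ j \o snd).
  by apply: measurableT_comp => //; exact: measurable_tnth.
by apply/funext => -[D D'] /=; rewrite tnth_rshift.
Qed.

Lemma iid_law_cat n m (A : set ((n + m).-tuple Z)) : measurable A ->
  (iid_law P n \x iid_law P m)%E (@cat_samples n m @^-1` A) =
  iid_law P (n + m) A.
Proof.
move=> mA; apply: iid_law_preimage => //; first exact: measurable_cat_samples.
move=> B mB.
rewrite (_ : _ @^-1` _ = box (B \o lshift m) `*` box (B \o @rshift n m)).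
  rewrite big_split_ord -!iid_law_boxE; [|by move=> i; exact: mB..].
  by apply: product_measure1E; apply: measurable_box => i; exact: mB.
apply/seteqP; split => -[D D'] /=; rewrite /box/=.
  move=> DB; split => i; first by have := DB (lshift m i); rewrite tnth_lshift.
  by have := DB (rshift n i); rewrite tnth_rshift.
move=> [DB DB'] i; case: (fintype.split_ordP i) => j ->.
  by rewrite tnth_lshift.
by rewrite tnth_rshift.
Qed.

Lemma integral_iid_law_prod n (g : Z -> R) : measurable_fun setT g ->
  (forall z, 0 <= g z) ->
  (\int[iid_law P n]_D (\prod_(i < n) g (tnth D i))%:E =
   (\int[P]_z (g z)%:E) ^+ n)%E.
Proof.
move=> mg g0; elim: n => [|n IH].
  under eq_integral do rewrite big_ord0.
  by rewrite integral_cst//= diracT mule1.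
have mprod k : measurable_fun setT
    (fun D : k.-tuple Z => \prod_(i < k) g (tnth D i)).
  apply: measurable_prod => i _.
  by apply: measurableT_comp => //; exact: measurable_tnth.
have mprodE k : measurable_fun setT
    (EFin \o (fun D : k.-tuple Z => \prod_(i < k) g (tnth D i))).
  by apply/measurable_EFinP; exact: mprod.
have prod0 k (D : k.-tuple Z) : 0 <= \prod_(i < k) g (tnth D i).
  by apply: prodr_ge0.
rewrite expeS.
transitivity (\int[P \x iid_law P n]_w
    (\prod_(i < n.+1) g (tnth (cons_pair w) i))%:E)%E.
  apply: ge0_integral_distribution; first exact: (mprodE n.+1).
  by move=> D; rewrite lee_fin.
rewrite (fubini_tonelli1
  (fun w => (\prod_(i < n.+1) g (tnth (cons_pair w) i))%:E))//=.
- rewrite /fubini_F -[RHS]ge0_integralZr//; first last.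
  + by apply: expe_ge0; apply: integral_ge0 => z _; rewrite lee_fin.
  + by move=> z _; rewrite lee_fin.
  + exact/measurable_EFinP.
  apply: eq_integral => z _; rewrite -IH -ge0_integralZl//; first last.
  + by rewrite lee_fin.
  + by move=> D _; rewrite lee_fin.
  + exact: mprodE.
  apply: eq_integral => D _; rewrite -EFinM big_ord_recl /cons_pair tnth0/=.
  by under eq_bigr do rewrite tnthS.
- apply: (measurableT_comp (mprodE n.+1)); exact: measurable_cons_pair.
- by move=> w; exact: prod0.
Qed.

End iid_law_theory.

(** * Tail bounds for i.i.d. samples *)

Section tail_bounds.
Context d (Z : measurableType d) (R : realType).
Variable P : probability Z R.

(** Markov's inequality, in the form that the indicator of E is at most f. *)
Lemma prob_le_integral d' (S : measurableType d') (Q : probability S R)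
    (E : set S) (f : S -> R) : measurable E -> measurable_fun setT f ->
  (forall x, 0 <= f x) -> (forall x, E x -> 1 <= f x) ->
  (Q E <= \int[Q]_x (f x)%:E)%E.
Proof.
move=> mE mf f0 f1; rewrite -(setIT E) -integral_indic//.
apply: ge0_le_integral => //.
- exact/measurable_EFinP.
- exact/measurable_EFinP.
- move=> x _; rewrite lee_fin indicE; case: (boolP (x \in E)) => // xE.
  by apply: f1; exact: set_mem.
Qed.

Lemma integral_expR_indic (B : set Z) (l : R) : measurable B -> 0 <= l ->
  (\int[P]_z (expR (l * \1_B z))%:E =
   (1 - fine (P B) + fine (P B) * expR l)%:E)%E.
Proof.
move=> mB l0.
have IB : (\int[P]_z (\1_B z)%:E = (fine (P B))%:E)%E.
  by rewrite integral_indic// setIT fineK// fin_num_measure.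
have el : 0 <= expR l - 1 by rewrite subr_ge0 -expR0 ler_expR.
transitivity (\int[P]_z (1%:E + (expR l - 1)%:E * (\1_B z)%:E))%E.
  apply: eq_integral => z _; rewrite indicE; case: (z \in B).
    by rewrite mulr1 mule1 -EFinD addrC subrK.
  by rewrite mulr0 mule0 expR0 adde0.
rewrite ge0_integralD//; last 2 first.
- by move=> z _; rewrite mule_ge0// lee_fin.
- apply: measurable_funeM; exact/measurable_EFinP.
rewrite integral_cst//= probability_setT mule1 ge0_integralZl//; last first.
  exact/measurable_EFinP.
by rewrite IB -EFinM -EFinD; congr (_%:E); ring.
Qed.

Lemma hoeffding_iid (B : set Z) n (e : R) : measurable B -> 0 <= e ->
  (iid_law P n [set D : n.-tuple Z |
     (n%:R * (fine (P B) + e) <= \sum_(i < n) \1_B (tnth D i))%R]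
   <= (expR (- (2 * n%:R * e ^+ 2)))%:E)%E.
Proof.
move=> mB e0; set p := fine (P B).
have p01 : 0 <= p <= 1.
  rewrite fine_ge0//= -lee_fin fineK ?fin_num_measure//.
  exact: probability_le1.
pose l := 4 * e; have l0 : 0 <= l by rewrite mulr_ge0.
pose g z : R := expR (l * \1_B z).
have mg : measurable_fun setT g.
  apply: measurableT_comp => //; apply: measurable_funM => //.
have msum : measurable_fun setT
    (fun D : n.-tuple Z => \sum_(i < n) \1_B (tnth D i) : R).
  apply: measurable_sum => i; apply: measurableT_comp => //.
  exact: measurable_tnth.
set K := expR (- (l * (n%:R * (p + e)))).
have mprod : measurable_fun setT
    (fun D : n.-tuple Z => \prod_(i < n) g (tnth D i)).
  apply: measurable_prod => i _; apply: measurableT_comp => //.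
  exact: measurable_tnth.
apply: le_trans (prob_le_integral (f := fun D => K * \prod_(i < n) g (tnth D i))
  _ _ _ _ _) _.
- rewrite -[X in measurable X]setTI; exact: measurable_fun_le.
- exact: measurable_funM.
- by move=> D; rewrite mulr_ge0 ?expR_ge0// prodr_ge0// => i _; exact: expR_ge0.
- move=> D /= h; rewrite -expR_sum -expRD -mulr_sumr -[leLHS]expR0 ler_expR.
  by rewrite addrC -mulrBr mulr_ge0// subr_ge0.
under eq_integral do rewrite EFinM.
rewrite ge0_integralZl//; last 3 first.
- exact/measurable_EFinP.
- by move=> D _; rewrite lee_fin prodr_ge0// => i _; exact: expR_ge0.
- by rewrite lee_fin expR_ge0.
rewrite integral_iid_law_prod//; last by move=> z; exact: expR_ge0.
rewrite integral_expR_indic// -EFin_expe -EFinM lee_fin.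
have := bernoulli_mgf_le p01 l0; rewrite -/p => mgf.
have mgf0 : 0 <= 1 - p + p * expR l.
  by have := expR_ge0 l; move: p01 => /andP[]; nra.
have : (1 - p + p * expR l) ^+ n <= expR (l * p + l ^+ 2 / 8) ^+ n.
  by rewrite lerXn2r// nnegrE expR_ge0.
move=> /(ler_wpM2l (expR_ge0 _)) => /(_ (- (l * (n%:R * (p + e))))).
move=> /le_trans; apply.
rewrite -expRM_natl -expRD ler_expR /l -mulr_natl; lra.
Qed.

(** An i.i.d. sample may first be drawn and then be permuted uniformly at
random: a bound on the share of permutations that is uniform in the sample
bounds the probability. *)
Lemma iid_law_le_perm_fraction n (E : set (n.-tuple Z)) (c : R) :
  measurable E ->
  (forall D, #|[set s : {perm 'I_n} | `[< E (perm_sample s D) >]]%SET|%:R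
             <= (n`!)%:R * c) ->
  (iid_law P n E <= c%:E)%E.
Proof.
move=> mE Ec.
have mEs s : measurable (perm_sample s @^-1` E).
  by rewrite -[X in measurable X]setTI; exact: measurable_perm_sample.
have fact0 : 0 < (n`!)%:R :> R by rewrite ltr0n fact_gt0.
rewrite -(@lee_pmul2l _ (n`!)%:R%:E)// -EFinM.
have -> : ((n`!)%:R%:E * iid_law P n E =
    \sum_(s : {perm 'I_n}) iid_law P n (perm_sample s @^-1` E))%E.
  rewrite (eq_bigr (fun=> iid_law P n E)); last first.
    by move=> s _; exact: iid_law_exchangeable.
  by rewrite sumr_const card_Sn mule_natl.
under eq_bigr do rewrite -(setIT (_ @^-1` _)) -integral_indic//.
rewrite -ge0_integral_sum//; last first.
  by move=> s; exact/measurable_EFinP.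
rewrite -[leRHS]mule1 -(@probability_setT _ _ _ (iid_law P n)) -integral_cst//.
apply: ge0_le_integral => //.
- by move=> D _; apply: sume_ge0 => s _; rewrite lee_fin.
- by apply: emeasurable_sum => s; exact/measurable_EFinP.
- move=> D _; rewrite sumEFin lee_fin; apply: le_trans (Ec D).
  rewrite -sum1_card natr_sum [leRHS]big_mkcond/=; apply: ler_sum => s _.
  by rewrite inE indicE; case: asboolP => DE; [rewrite mem_set|rewrite memNset].
Qed.

End tail_bounds.

(** * Quantiles and the jackknife+ interval *)

Section quantiles.
Variable R : realType.

(** The infimum is attained at the largest v i below u, so that the strict
inequality passes to the count. *)
Lemma quantile_ltP n (v : 'I_n -> R) (tau u : R) : (0 < n)%N -> 0 < tau ->
  (quantile v tau < u%:E)%E <-> tau * n%:R <= #|[set i | v i < u]%SET|%:R.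
Proof.
move=> n0 tau0; split.
  move=> /ereal_inf_lt[_ [t /= tv <-]]; rewrite lte_fin => tu.
  apply: le_trans tv _; rewrite ler_nat subset_leq_card//.
  by apply/fintype.subsetP => i; rewrite !inE => /le_lt_trans; apply.
move=> tau_le.
have : (0 < #|[set i | (v i < u)%R]%SET|)%N.
  by rewrite -(ltr_nat R); apply: lt_le_trans tau_le; rewrite mulr_gt0// ltr0n.
move=> /card_gt0P[i0]; rewrite inE => vi0.
have [k vk kmax] := @arg_maxP _ _ _ _ [pred i | v i < u] v vi0.
apply: le_lt_trans (_ : ((v k)%:E < u%:E)%E); last by rewrite lte_fin.
apply: ereal_inf_lbound; exists (v k) => //=.
apply: le_trans tau_le _; rewrite ler_nat subset_leq_card//.
by apply/fintype.subsetP => i; rewrite !inE; exact: kmax.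
Qed.

End quantiles.

Section jackknife_theory.
Context d (X : measurableType d) (R : realType).
Variable A : regression_algorithm X R.
Implicit Type alpha gamma : R.

Lemma symmetric_perm_eq (hsym : symmetric_algorithm A) (u v : seq (X * R)) :
  perm_eq u v -> A u = A v.
Proof.
case: u => [|z u]; first by rewrite perm_sym => /perm_nilP ->.
move=> uv; have [s us] := tuple_permP (t := in_tuple v) uv.
by rewrite us -(hsym _ (in_tuple v) s)// -(perm_size uv).
Qed.

(** Training sets are lists of positions in a sample: the fits on different
subsets of one sample can then be permuted together. *)
Definition loo_indices n (i : 'I_n) : seq 'I_n := rem i (enum 'I_n).

Lemma loo_fitE n (D : n.-tuple (X * R)) i :
  loo_fit A D i = A [seq tnth D k | k <- loo_indices i].
Proof.
rewrite /loo_fit /loo_indices remE index_enum_ord map_cat map_take map_drop.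
by rewrite -[in LHS](map_tnth_enum D).
Qed.

(** Miscoverage as a count of indices: this form is visibly measurable and
compares with the residuals one index at a time. *)
Lemma not_jplus_intervalP alpha gamma n (D : n.-tuple (X * R)) x y :
  (0 < n)%N -> alpha < 1 ->
  ~ jplus_interval A alpha gamma D x y <->
    (jplus_level alpha n * n%:R <=
      #|[set i | gamma + loo_residual A D i < y - loo_fit A D i x]%SET|%:R) \/
    (jplus_level alpha n * n%:R <=
      #|[set i | gamma + loo_residual A D i < loo_fit A D i x - y]%SET|%:R).
Proof.
move=> n0 alpha1.
have tau0 : 0 < jplus_level alpha n.
  by rewrite mulr_gt0 ?subr_gt0// ltr_wpDr// invr_ge0.
have up : (jplus_upper A alpha gamma D x < y%:E)%E <->
    (jplus_level alpha n * n%:R <=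
      #|[set i | gamma + loo_residual A D i < y - loo_fit A D i x]%SET|%:R).
  rewrite /jplus_upper -lteBrDr// -EFinB; split.
    move=> /(quantile_ltP _ _ n0 tau0); congr (_ <= #|pred_of_set _|%:R).
    by apply/setP => i; rewrite !inE; apply/idP/idP; lra.
  move=> h; apply/(quantile_ltP _ _ n0 tau0); move: h.
  congr (_ <= #|pred_of_set _|%:R).
  by apply/setP => i; rewrite !inE; apply/idP/idP; lra.
have down : (y%:E < jplus_lower A alpha gamma D x)%E <->
    (jplus_level alpha n * n%:R <=
      #|[set i | gamma + loo_residual A D i < loo_fit A D i x - y]%SET|%:R).
  rewrite /jplus_lower lteBrDr// -EFinD lteNr -EFinN; split.
    move=> /(quantile_ltP _ _ n0 tau0); congr (_ <= #|pred_of_set _|%:R).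
    by apply/setP => i; rewrite !inE; apply/idP/idP; lra.
  move=> h; apply/(quantile_ltP _ _ n0 tau0); move: h.
  congr (_ <= #|pred_of_set _|%:R).
  by apply/setP => i; rewrite !inE; apply/idP/idP; lra.
rewrite /jplus_interval/= -up -down; split.
  move=> /not_andP[|] /negP; rewrite -ltNge; [by right|by left].
by move=> [|]; rewrite ltNge => /negP h [].
Qed.

End jackknife_theory.

(** * Out-of-sample stability as an expected leave-one-out gap *)

Section counting_measurability.
Context d (T : measurableType d) (R : realType) (I : finType).

Lemma measurable_true_set (b : T -> bool) :
  measurable_fun setT b -> measurable [set w | b w].
Proof.
by move=> mb; rewrite -[X in measurable X]setTI; exact: (mb _ [set true]).
Qed.

Lemma measurable_card_set (b : I -> T -> bool) :
  (forall i, measurable_fun setT (b i)) ->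
  measurable_fun setT (fun w => #|[set i | b i w]%SET|%:R : R).
Proof.
move=> mb; have -> : (fun w => #|[set i | b i w]%SET|%:R : R) =
    (fun w => \sum_i (if b i w then 1 else 0)).
  apply/funext => w; rewrite -sum1_card natr_sum big_mkcond/=.
  by apply: eq_bigr => i _; rewrite inE.
by apply: measurable_sum => i; apply: measurable_fun_ifT.
Qed.

End counting_measurability.

Section stability.
Context d (X : measurableType d) (R : realType).
Variables (A : regression_algorithm X R) (P : probability (X * R)%type R).
Hypothesis hmeas : measurable_algorithm A.
Hypothesis hsym : symmetric_algorithm A.

Let Z : measurableType _ := (X * R)%type.

Definition fit_on N (S : seq 'I_N) (V : N.-tuple (X * R)) : X -> R :=
  A [seq tnth V k | k <- S].

Lemma measurable_fit_on N (S : seq 'I_N) :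
  measurable_fun setT (fun w : N.-tuple (X * R) * X => fit_on S w.1 w.2).
Proof.
pose f (w : N.-tuple (X * R) * X) :=
  ([tuple of [seq tnth w.1 k | k <- in_tuple S]] : (size S).-tuple _, w.2).
have mf : measurable_fun setT f.
  apply/measurable_fun_pairP; split; last exact: measurable_snd.
  apply/measurable_fun_tnthP => i.
  rewrite (_ : _ \o _ = (@tnth N Z)^~ (tnth (in_tuple S) i) \o fst).
    by apply: measurableT_comp => //; exact: measurable_tnth.
  by apply/funext => w /=; rewrite tnth_map.
exact: (measurableT_comp (hmeas (n := size S)) mf).
Qed.

Definition loo_gap N (S : seq 'I_N) (k : 'I_N) (V : N.-tuple (X * R)) : R :=
  `| fit_on S V (tnth V k).1 - fit_on (loo_indices k) V (tnth V k).1 |.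

Lemma measurable_fit_at N (S : seq 'I_N) k :
  measurable_fun setT (fun V : N.-tuple (X * R) => fit_on S V (tnth V k).1).
Proof.
have mf : measurable_fun setT (fun V : N.-tuple (X * R) => (V, (tnth V k).1)).
  apply/measurable_fun_pairP; split; first exact: measurable_id.
  apply: (@measurableT_comp _ _ _ _ _ _ fst) => //.
  exact: (@measurable_tnth _ Z).
exact: (measurableT_comp (measurable_fit_on S) mf).
Qed.

Lemma measurable_loo_gap N (S : seq 'I_N) k : measurable_fun setT (loo_gap S k).
Proof.
apply: measurableT_comp => //; apply: measurable_funB; exact: measurable_fit_at.
Qed.

Lemma integral_perm_sample N (s : {perm 'I_N}) (h : N.-tuple (X * R) -> R) :
  measurable_fun setT h -> (forall V, 0 <= h V) ->
  (\int[iid_law P N]_V (h (perm_sample s V))%:E =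
   \int[iid_law P N]_V (h V)%:E)%E.
Proof.
move=> mh h0.
transitivity (\int[distribution (iid_law P N) (perm_sample s)]_V (h V)%:E)%E.
  rewrite ge0_integral_distribution//; exact/measurable_EFinP.
by apply: eq_measure_integral => B mB _; exact: (iid_law_exchangeable P s mB).
Qed.

(** Rearrange the sample so that k comes first, then S, then the other
positions: the law does not change, the first point becomes the test point,
and the two training sets become the first n and all of the remaining
n + m points. *)
Lemma expected_loo_gap n m (S : seq 'I_(n + m).+1) k :
  uniq (k :: S) -> size S = n ->
  (\int[iid_law P (n + m).+1]_V (loo_gap S k V)%:E = beta_out A P m n)%E.
Proof.
move=> uS szS; set N := (n + m).+1.
pose L := k :: S ++ [seq l <- enum 'I_N | l \notin k :: S].
have uL : uniq L.
  rewrite /L -cat_cons cat_uniq uS filter_uniq ?enum_uniq// andbT.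
  by apply/hasPn => l; rewrite mem_filter => /andP[].
have memL l : l \in L.
  rewrite /L -cat_cons mem_cat mem_filter mem_enum andbT.
  by case: (l \in k :: S).
have permL : perm_eq L (enum 'I_N).
  by apply: uniq_perm => //; [exact: enum_uniq|move=> l; rewrite memL mem_enum].
have szL : size L == N by rewrite (perm_size permL) size_enum_ord.
have injL : injective (tnth (Tuple szL)).
  by apply/tuple_uniqP.
pose s := perm injL.
have sL (V : N.-tuple (X * R)) :
    perm_sample s V = [seq tnth V l | l <- L] :> seq _.
  transitivity (val (map_tuple (tnth V) (Tuple szL))) => //.
  congr val; apply: eq_from_tnth => i.
  by rewrite tnth_mktuple tnth_map permE.
pose h (w : (X * R) * (n + m).-tuple (X * R)) : R :=
  `| A (take n w.2) w.1.1 - A w.2 w.1.1 |.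
pose H (V : N.-tuple (X * R)) := h (thead V, [tuple of behead V]).
have gapH V : loo_gap S k V = H (perm_sample s V).
  rewrite /H /h/= (_ : thead _ = tnth V k); last first.
    by rewrite /thead tnth_mktuple permE.
  rewrite /loo_gap /fit_on sL/=; congr `| _ - _ |.
    by rewrite map_cat take_size_cat ?size_map.
  congr (_ _); congr (MeasurableFun.sort _); apply: symmetric_perm_eq => //.
  apply: perm_map; rewrite -(perm_cons k) -/L (perm_sym _ L).
  by apply: perm_trans permL _; apply: perm_to_rem; rewrite mem_enum.
have mh : measurable_fun setT h.
  have mswap : measurable_fun setT
      (fun w : (X * R) * (n + m).-tuple (X * R) => (w.2, w.1.1)).
    apply/measurable_fun_pairP; split; first exact: measurable_snd.
    by apply: (@measurableT_comp _ _ _ _ _ _ fst).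
  rewrite (_ : h = fun w => `| fit_on (take n (enum 'I_(n + m))) w.2 w.1.1 -
                               fit_on (enum 'I_(n + m)) w.2 w.1.1 |).
    apply: measurableT_comp => //; apply: measurable_funB.
      exact: (measurableT_comp (measurable_fit_on (take n (enum _))) mswap).
    exact: (measurableT_comp (measurable_fit_on (enum _)) mswap).
  by apply/funext => w; rewrite /fit_on map_take !map_tnth_enum.
have mH : measurable_fun setT H.
  apply: (@measurableT_comp _ _ _ _ _ _ h) => //.
  apply/measurable_fun_pairP; split; first exact: (@measurable_tnth _ Z).
  exact: (@measurable_behead _ Z).
have H0 V : 0 <= H V by rewrite /H /h.
transitivity (\int[iid_law P N]_V (H V)%:E)%E.
  rewrite -(integral_perm_sample s mH H0).
  by apply: eq_integral => V _; rewrite gapH.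
transitivity (\int[P \x iid_law P (n + m)]_w (h w)%:E)%E.
  transitivity (\int[P \x iid_law P (n + m)]_w (H (cons_pair w))%:E)%E.
    apply: ge0_integral_distribution; first exact/measurable_EFinP.
    by move=> V; rewrite lee_fin.
  apply: eq_integral => -[z V] _; rewrite /H; congr (h (_, _))%:E.
  exact: val_inj.
have mhE : measurable_fun setT (EFin \o h) by exact/measurable_EFinP.
have hE0 w : (0 <= (EFin \o h) w)%E by rewrite lee_fin normr_ge0.
pose h' (w : (n + m).-tuple (X * R) * (X * R)) := (h (w.2, w.1))%:E.
have mh' : measurable_fun setT h'.
  by apply: (measurableT_comp mhE); exact: measurable_swap.
rewrite /beta_out unlock (fubini_tonelli1 (EFin \o h) mhE hE0).
rewrite [RHS](fubini_tonelli1 h' mh' (fun w => hE0 (w.2, w.1))).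
exact: (fubini_tonelli (EFin \o h) mhE hE0).
Qed.

End stability.

(** * Exchangeability and stability of the pooled sample *)

Section pooled_sample.
Context d (X : measurableType d) (R : realType).
Variables (A : regression_algorithm X R) (P : probability (X * R)%type R).
Hypothesis hmeas : measurable_algorithm A.
Hypothesis hsym : symmetric_algorithm A.

Let Z : measurableType _ := (X * R)%type.

Definition pool_residual N (V : N.-tuple (X * R)) (k : 'I_N) : R :=
  `| (tnth V k).2 - fit_on A (loo_indices k) V (tnth V k).1 |.

Lemma measurable_pool_residual N (k : 'I_N) :
  measurable_fun setT (fun V : N.-tuple (X * R) => pool_residual V k).
Proof.
apply: measurableT_comp => //; apply: measurable_funB.
  apply: (@measurableT_comp _ _ _ _ _ _ snd) => //.
  exact: (@measurable_tnth _ Z).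
exact: measurable_fit_at.
Qed.

(** The data set without the k-th point of a permuted pool is, up to order, the
pool without its s k-th point. *)
Lemma pool_residual_perm N (s : {perm 'I_N}) (V : N.-tuple (X * R)) k :
  pool_residual (perm_sample s V) k = pool_residual V (s k).
Proof.
rewrite /pool_residual /fit_on !tnth_mktuple.
rewrite (_ : [seq tnth _ l | l <- _] =
    [seq tnth V l | l <- [seq s l | l <- loo_indices k]]); last first.
  by rewrite -map_comp; apply: eq_map => l /=; rewrite tnth_mktuple.
rewrite (@symmetric_perm_eq _ _ _ A hsym _
  [seq tnth V l | l <- loo_indices (s k)])//.
apply/perm_map/uniq_perm.
- by rewrite map_inj_uniq ?rem_uniq ?enum_uniq//; exact: perm_inj.
- by rewrite rem_uniq ?enum_uniq.
- move=> l; rewrite -(permKV s l) mem_map; last exact: perm_inj.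
  by rewrite !mem_rem_uniq ?enum_uniq// !inE !mem_enum (inj_eq perm_inj).
Qed.

Lemma measurable_exceeders_event N (I J : {set 'I_N}) (theta u : R) :
  measurable [set V : N.-tuple (X * R) |
    u < #|rank_exceeders (pool_residual V) I J theta|%:R].
Proof.
apply: measurable_true_set; apply: measurable_fun_ltr => //.
apply: measurable_card_set => j.
apply: measurable_and => //.
apply: measurable_fun_ler => //.
apply: measurable_card_set => i; apply: measurable_and => //.
apply: measurable_fun_ler; exact: measurable_pool_residual.
Qed.

Lemma pool_exceeders_prob N (I J : {set 'I_N}) (theta e : R) :
  0 <= theta -> 0 <= e ->
  (iid_law P N [set V | ((theta + 2 * e) * #|J|%:R <
     #|rank_exceeders (pool_residual V) I J theta|%:R)%R]
   <= (expR (- (2 * #|I|%:R * e ^+ 2)) + expR (- (2 * #|J|%:R * e ^+ 2)))%:E)%E.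
Proof.
move=> theta0 e0; apply: iid_law_le_perm_fraction.
  exact: measurable_exceeders_event.
move=> V; have := rank_exceeders_le (pool_residual V) I J theta0 e0.
rewrite card_ord; apply: le_trans; rewrite ler_nat subset_leq_card//.
apply/fintype.subsetP => s; rewrite !inE /=.
have -> : pool_residual (perm_sample s V) = pool_residual V \o s.
  by apply/funext => k; exact: pool_residual_perm.
exact: id.
Qed.

Section train_test.
Variables (n m : nat) (gamma : R).
Hypotheses (n0 : (0 < n)%N) (m0 : (0 < m)%N) (gamma0 : 0 < gamma).

Definition train_indices : {set 'I_(n + m)} := [set lshift m i | i : 'I_n].
Definition test_indices : {set 'I_(n + m)} := [set rshift n j | j : 'I_m].

Lemma card_train_indices : #|train_indices| = n.
Proof. by rewrite card_imset ?card_ord//; exact: (@lshift_inj n m). Qed.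

Lemma card_test_indices : #|test_indices| = m.
Proof. by rewrite card_imset ?card_ord//; exact: (@rshift_inj n m). Qed.

Definition train_gap (V : (n + m).-tuple (X * R)) (i : 'I_n) k : R :=
  loo_gap A [seq lshift m l | l <- loo_indices i] k V.

(** The pairs whose two gaps are too large for the inflation gamma to absorb. *)
Definition unstable_pairs (V : (n + m).-tuple (X * R)) : {set 'I_n * 'I_m} :=
  [set ij | gamma < train_gap V ij.1 (lshift m ij.1) +
                    train_gap V ij.1 (rshift n ij.2)].

Lemma lshift_notin_loo (i : 'I_n) :
  lshift m i \notin [seq lshift m l | l <- loo_indices i].
Proof.
rewrite mem_map; last exact: (@lshift_inj n m).
by rewrite mem_rem_uniq ?enum_uniq// !inE eqxx.
Qed.

Lemma rshift_notin_loo (j : 'I_m) (i : 'I_n) :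
  rshift n j \notin [seq lshift m l | l <- loo_indices i].
Proof. by apply/mapP => -[l _] /eqP; rewrite eq_rlshift. Qed.

Lemma measurable_train_gap (i : 'I_n) k :
  measurable_fun setT (fun V => train_gap V i k).
Proof. exact: measurable_loo_gap. Qed.

Lemma expected_train_gap (i : 'I_n) k :
  k \notin [seq lshift m l | l <- loo_indices i] ->
  (\int[iid_law P (n + m)]_V (train_gap V i k)%:E = beta_out A P m n.-1)%E.
Proof.
move: i k; rewrite /train_gap; case: n n0 => // n' _ i k kS.
apply: (@expected_loo_gap _ _ _ A P hmeas hsym n' m) => //=.
  by rewrite kS map_inj_uniq ?rem_uniq ?enum_uniq//; exact: lshift_inj.
by rewrite size_map size_rem ?mem_enum// size_enum_ord.
Qed.

Lemma measurable_unstable_event (u : R) :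
  measurable [set V | u < #|unstable_pairs V|%:R].
Proof.
apply: measurable_true_set; apply: measurable_fun_ltr => //.
apply: measurable_card_set => ij; apply: measurable_fun_ltr => //.
by apply: measurable_funD; exact: measurable_train_gap.
Qed.

(** The number of unstable pairs is at most S / gamma, where the sum S of all
gaps of all pairs has mean n m (2 b). *)
Lemma unstable_pairs_prob (b c : R) : beta_out A P m n.-1 = b%:E ->
  0 <= c -> c ^+ 3 = 2 * b / gamma ->
  (iid_law P (n + m) [set V |
     (c ^+ 2 * (n * m)%:R < #|unstable_pairs V|%:R)%R] <= c%:E)%E.
Proof.
move=> betaE c0 c3.
have nm0 : 0 < (n * m)%:R :> R by rewrite ltr0n muln_gt0 n0 m0.
pose S V := \sum_(ij : 'I_n * 'I_m) (train_gap V ij.1 (lshift m ij.1) +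
                                     train_gap V ij.1 (rshift n ij.2)).
have gap_ge0 V i k : 0 <= train_gap V i k by exact: normr_ge0.
have mgap2 (ij : 'I_n * 'I_m) : measurable_fun setT (fun V =>
    train_gap V ij.1 (lshift m ij.1) + train_gap V ij.1 (rshift n ij.2)).
  by apply: measurable_funD; exact: measurable_train_gap.
have mS : measurable_fun setT S by apply: measurable_sum.
have S0 V : 0 <= S V by apply: sumr_ge0 => ij _; exact: addr_ge0.
have ES : (\int[iid_law P (n + m)]_V (S V)%:E = ((n * m)%:R * (2 * b))%:E)%E.
  under eq_integral do rewrite -sumEFin.
  rewrite ge0_integral_sum//; last 2 first.
  - by move=> ij; exact/measurable_EFinP.
  - by move=> ij V _; rewrite lee_fin addr_ge0.
  rewrite (eq_bigr (fun=> (2 * b)%:E)); last first.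
    move=> ij _; under eq_integral do rewrite EFinD.
    rewrite ge0_integralD//; last 4 first.
    - by move=> V _; rewrite lee_fin.
    - apply/measurable_EFinP; exact: measurable_train_gap.
    - by move=> V _; rewrite lee_fin.
    - apply/measurable_EFinP; exact: measurable_train_gap.
    rewrite !expected_train_gap ?betaE ?lshift_notin_loo ?rshift_notin_loo//.
    by rewrite -EFinD mulr_natl mulr2n.
  by rewrite sumEFin sumr_const card_prod !card_ord [in RHS]mulr_natl.
have SV V : gamma * #|unstable_pairs V|%:R <= S V.
  rewrite mulr_natr -sumr_const big_mkcond/=; apply: ler_sum => ij _.
  by rewrite inE; case: ifPn => [/ltW//|_]; exact: addr_ge0.
(* For c = 0 the threshold of the event is 0, which Markov's inequality cannot
   use; but a positive number of pairs is at least 1. *)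
pose K : R := if c == 0 then 1 else c ^+ 2 * (n * m)%:R.
have K0 : 0 < K.
  rewrite /K; case: eqVneq => // cn0.
  by rewrite mulr_gt0// exprn_gt0// lt_def cn0.
have KU V : c ^+ 2 * (n * m)%:R < #|unstable_pairs V|%:R ->
    K <= #|unstable_pairs V|%:R.
  rewrite /K; case: eqVneq => [->|_]; last exact: ltW.
  by rewrite expr0n mul0r ltr0n ler1n.
apply: le_trans (prob_le_integral (f := fun V => (K * gamma)^-1 * S V)
  _ _ _ _ _) _.
- exact: measurable_unstable_event.
- exact: measurable_funM.
- by move=> V; rewrite mulr_ge0// invr_ge0 mulr_ge0// ltW.
- move=> V /= /KU KV; rewrite ler_pdivlMl ?mulr_gt0// mulr1.
  by apply: le_trans (SV V); rewrite mulrC ler_pM2l.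
under eq_integral do rewrite EFinM.
rewrite ge0_integralZl//; last 3 first.
- exact/measurable_EFinP.
- by move=> V _; rewrite lee_fin.
- by rewrite lee_fin invr_ge0 mulr_ge0// ltW.
rewrite ES -EFinM lee_fin.
have -> : (K * gamma)^-1 * ((n * m)%:R * (2 * b)) =
    K^-1 * ((n * m)%:R * c ^+ 3).
  by rewrite c3; field; rewrite !gt_eqF.
rewrite ler_pdivrMl// /K; case: eqVneq => [->|_].
  by rewrite expr0n mulr0 mul1r.
by rewrite le_eqVlt; apply/orP; left; apply/eqP; ring.
Qed.

End train_test.
End pooled_sample.

(** * Miscovered test points have large residuals *)

Section deterministic_comparison.
Context d (X : measurableType d) (R : realType).
Variable A : regression_algorithm X R.
Variables (n m : nat) (alpha gamma : R).
Hypotheses (n0 : (0 < n)%N) (alpha1 : alpha < 1).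
Variables (D : n.-tuple (X * R)) (D' : m.-tuple (X * R)).

Let V : (n + m).-tuple (X * R) := cat_samples (D, D').
Let r := pool_residual A V.
Let U := unstable_pairs A gamma V.

Lemma fit_on_cat (i : 'I_n) :
  fit_on A [seq lshift m l | l <- loo_indices i] V = loo_fit A D i.
Proof.
rewrite loo_fitE /fit_on -map_comp; congr (MeasurableFun.sort (A _)).
by apply: eq_map => l /=; rewrite tnth_lshift.
Qed.

(** Two triangle inequalities: passing to the pool fits costs one gap at i and
one gap at j. *)
Lemma stable_pair_residual (i : 'I_n) (j : 'I_m) : (i, j) \notin U ->
  gamma + loo_residual A D i <
    `| (tnth D' j).2 - loo_fit A D i (tnth D' j).1 | ->
  r (lshift m i) < r (rshift n j).
Proof.
rewrite inE /= -leNgt /train_gap /loo_gap !fit_on_cat.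
rewrite /r /pool_residual /loo_residual /V !tnth_lshift !tnth_rshift.
set f := fit_on A (loo_indices (lshift m i)) _ _.
set g := fit_on A (loo_indices (rshift n j)) _ _.
set u := loo_fit A D i _; set v := loo_fit A D i _.
have := ler_distD u (tnth D i).2 f.
have := ler_distD g (tnth D' j).2 v.
rewrite (distrC g v); lra.
Qed.

Definition miscovered_tests : {set 'I_m} :=
  [set j | `[< ~ jplus_interval A alpha gamma D (tnth D' j).1 (tnth D' j).2 >]].

Let unstable_with (j : 'I_m) : {set 'I_n} := [set i | (i, j) \in U].

(** Miscoverage puts j beyond at least (1 - alpha) (n + 1) of the inflated
bounds, and each of them either is unstable with j or has a residual below
that of j. *)
Lemma miscovered_test_exceeds j : j \in miscovered_tests ->
  (1 - alpha) * n%:R <=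
    #|[set i : 'I_n | r (lshift m i) < r (rshift n j)]%SET|%:R +
    #|unstable_with j|%:R.
Proof.
rewrite inE => /asboolP.
move=> /(@not_jplus_intervalP _ _ _ A alpha gamma n D _ _ n0 alpha1) mis.
have level_ge : (1 - alpha) * n%:R <= jplus_level alpha n * n%:R.
  rewrite ler_wpM2r// ler_peMr//; first by rewrite subr_ge0 ltW.
  by rewrite lerDl invr_ge0.
pose far := [set i : 'I_n | gamma + loo_residual A D i <
  `| (tnth D' j).2 - loo_fit A D i (tnth D' j).1 |]%SET.
have level_le : jplus_level alpha n * n%:R <= #|far|%:R.
  case: mis => /le_trans; apply; rewrite ler_nat subset_leq_card//.
    apply/fintype.subsetP => i; rewrite !inE => /lt_le_trans; apply.
    exact: ler_norm.
  apply/fintype.subsetP => i; rewrite !inE distrC => /lt_le_trans; apply.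
  exact: ler_norm.
apply: le_trans level_ge _; apply: le_trans level_le _.
rewrite -natrD ler_nat; apply: leq_trans (leq_card_setU _ _).
apply/subset_leq_card/fintype.subsetP => i; rewrite !inE => farj.
by apply/orP; have [ijU|ijU] := boolP ((i, j) \in U);
  [right; rewrite inE in ijU|left; exact: stable_pair_residual].
Qed.

Lemma card_train_filter (p : pred 'I_(n + m)) :
  #|[set k in train_indices n m | p k]%SET| = #|[set i | p (lshift m i)]%SET|.
Proof.
rewrite -(card_imset _ (@lshift_inj n m)); apply: eq_card => k; rewrite !inE.
apply/andP/imsetP => [[/imsetP[i _ ->] pk]|[i]].
  by exists i; rewrite ?inE.
by rewrite inE => pi ->; split => //; apply: imset_f.
Qed.

(** If at most a fraction c^2 of all pairs is unstable, then at most a fraction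
c of the test points is in more than c n unstable pairs. *)
Lemma card_miscovered_tests (c : R) : 0 <= c ->
  #|U|%:R <= c ^+ 2 * (n * m)%:R ->
  #|miscovered_tests|%:R <= c * m%:R +
    #|rank_exceeders r (train_indices n m) (test_indices n m) (alpha + c)|%:R.
Proof.
move=> c0 Uc; set E := rank_exceeders _ _ _ _.
pose W := [set j : 'I_m | c * n%:R < #|unstable_with j|%:R]%SET.
have UE : #|U|%:R = \sum_(j : 'I_m) #|unstable_with j|%:R :> R.
  rewrite -natr_sum; congr (_%:R).
  transitivity (\sum_(i < n) \sum_(j < m) ((i, j) \in U : nat))%N.
    rewrite pair_big -sum1_card big_mkcond/=.
    by apply: eq_big => // -[i j] _ /=; case: ((i, j) \in U).
  rewrite exchange_big; apply: eq_bigr => j _.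
  rewrite -sum1_card [RHS]big_mkcond/=.
  by apply: eq_bigr => i _; rewrite [in RHS]inE; case: ((i, j) \in U).
have Wc : #|W|%:R <= c * m%:R.
  have WU : #|W|%:R * (c * n%:R) <= c ^+ 2 * (n * m)%:R.
    apply: le_trans Uc; rewrite UE mulr_natl -sumr_const [leLHS]big_mkcond/=.
    by apply: ler_sum => j _; rewrite inE; case: ifPn => [/ltW//|_].
  have [c_eq0|cn0] := eqVneq c 0; last first.
    have cn : 0 < c * n%:R by rewrite mulr_gt0 ?ltr0n// lt_def cn0.
    rewrite -(ler_pM2r cn); apply: le_trans WU _.
    by rewrite natrM le_eqVlt; apply/orP; left; apply/eqP; ring.
  rewrite c_eq0 mul0r (_ : W = finset.set0) ?cards0//.
  apply/setP => j; rewrite !inE c_eq0 mul0r; apply/negbTE; rewrite -leNgt.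
  move: Uc; rewrite UE c_eq0 expr0n mul0r; apply: le_trans.
  by rewrite (bigD1 j)//= lerDl sumr_ge0.
apply: le_trans (lerD Wc (lexx _)); rewrite -natrD ler_nat.
have shiftE (B : {set 'I_m}) : #|B| = #|[set rshift n j | j in B]%SET|.
  by rewrite card_imset//; exact: rshift_inj.
rewrite (shiftE W) (shiftE miscovered_tests).
apply: leq_trans (leq_card_setU _ _).
apply/subset_leq_card/fintype.subsetP => _ /imsetP[j jmis ->].
rewrite inE; apply/orP; have [jW|jW] := boolP (j \in W).
  by left; apply: imset_f.
right; rewrite inE imset_f//= card_train_filter card_train_indices.
have := miscovered_test_exceeds jmis.
have : #|unstable_with j|%:R <= c * n%:R by move: jW; rewrite inE -leNgt.
have : #|[set i : 'I_n | r (lshift m i) < r (rshift n j)]%SET|%:R +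
    #|[set i : 'I_n | r (rshift n j) <= r (lshift m i)]%SET|%:R = n%:R :> R.
  rewrite -natrD -[in RHS](card_ord n).
  rewrite -(cardsC [set i : 'I_n | r (lshift m i) < r (rshift n j)]%SET).
  by congr (_ + _)%:R; apply: eq_card => i; rewrite !inE -leNgt.
lra.
Qed.

End deterministic_comparison.

(** * The miscoverage rate of a fixed training sample *)

Section conditional_tail_bound.
Context d d' (S : measurableType d) (Z : measurableType d') (R : realType).
Variables (Q : probability S R) (P : probability Z R).

Lemma measurable_hoeffding_event (C : set (S * Z)) m (e : R) : measurable C ->
  measurable [set w : S * m.-tuple Z |
    m%:R * (fine (P (xsection C w.1)) + e) <=
      \sum_(j < m) \1_C (w.1, tnth w.2 j)].
Proof.
move=> mC; apply: measurable_true_set; apply: measurable_fun_ler.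
  apply: measurable_funM => //; apply: measurable_funD => //.
  apply: (@measurableT_comp _ _ _ _ _ _ fine) => //.
  apply: (@measurableT_comp _ _ _ _ _ _ (P \o xsection C)) => //.
  exact: measurable_fun_xsection.
apply: measurable_sum => j; apply: measurableT_comp => //.
apply/measurable_fun_pairP; split; first exact: measurable_fst.
exact: (measurableT_comp (measurable_tnth j) measurable_snd).
Qed.

(** Hoeffding's inequality holds for each value of the first component, with a
bound that does not depend on it. *)
Lemma hoeffding_conditional (C : set (S * Z)) m (e : R) :
  measurable C -> 0 <= e ->
  ((Q \x iid_law P m) [set w : S * m.-tuple Z |
    (m%:R * (fine (P (xsection C w.1)) + e) <=
      \sum_(j < m) \1_C (w.1, tnth w.2 j))%R]
   <= (expR (- (2 * m%:R * e ^+ 2)))%:E)%E.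
Proof.
move=> mC e0; set E := (X in (_ \x _)%E X).
have mE : measurable E by exact: measurable_hoeffding_event.
rewrite -[leRHS]mule1 -(@probability_setT _ _ _ Q) -integral_cst//.
apply: ge0_le_integral => //.
- exact: measurable_fun_xsection.
move=> x _ /=.
have mCx : measurable (xsection C x) by exact: measurable_xsection.
apply: le_trans (hoeffding_iid P m mCx e0).
rewrite le_eqVlt; apply/orP; left; apply/eqP; congr (iid_law P m _).
have indicE' z : \1_(xsection C x) z = \1_C (x, z) :> R.
  by rewrite !indicE mem_xsection.
have sumE (D : m.-tuple Z) : \sum_(j < m) \1_(xsection C x) (tnth D j) =
    \sum_(j < m) \1_C (x, tnth D j) :> R by apply: eq_bigr.
apply/seteqP; split => D; first by move=> /set_mem; rewrite /E/= sumE.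
by rewrite /= sumE => h; apply/mem_set.
Qed.

End conditional_tail_bound.

Section miscoverage.
Context d (X : measurableType d) (R : realType).
Variables (A : regression_algorithm X R) (P : probability (X * R)%type R).
Hypothesis hmeas : measurable_algorithm A.
Variables (alpha gamma : R) (n : nat).
Hypotheses (n0 : (0 < n)%N) (alpha1 : alpha < 1).

Let Z : measurableType _ := (X * R)%type.

Definition miscovered : set (n.-tuple (X * R) * (X * R)) :=
  [set w | ~ jplus_interval A alpha gamma w.1 w.2.1 w.2.2].

Lemma measurable_miscovered : measurable miscovered.
Proof.
have mfit i : measurable_fun setT
    (fun w : n.-tuple (X * R) * (X * R) => loo_fit A w.1 i w.2.1).
  rewrite (_ : (fun _ => _) = fun w => fit_on A (loo_indices i) w.1 w.2.1).
    have mp : measurable_fun setT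
        (fun w : n.-tuple (X * R) * (X * R) => (w.1, w.2.1)).
      apply/measurable_fun_pairP; split; first exact: measurable_fst.
      by apply: (@measurableT_comp _ _ _ _ _ _ fst).
    exact: (measurableT_comp (measurable_fit_on hmeas (loo_indices i)) mp).
  by apply/funext => w; rewrite loo_fitE.
have mres i : measurable_fun setT
    (fun w : n.-tuple (X * R) * (X * R) => loo_residual A w.1 i).
  rewrite (_ : (fun _ => _) = (fun D => pool_residual A D i) \o fst).
    apply: measurableT_comp => //; exact: measurable_pool_residual.
  by apply/funext => w; rewrite /loo_residual loo_fitE.
have my : measurable_fun setT (fun w : n.-tuple (X * R) * (X * R) => w.2.2).
  by apply: (@measurableT_comp _ _ _ _ _ _ snd).
pose far (f : X * R -> 'I_n -> n.-tuple (X * R) -> R) :=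
  [set w : n.-tuple (X * R) * (X * R) | jplus_level alpha n * n%:R <=
    #|[set i | gamma + loo_residual A w.1 i < f w.2 i w.1]%SET|%:R].
rewrite (_ : miscovered = far (fun z i D => z.2 - loo_fit A D i z.1) `|`
  far (fun z i D => loo_fit A D i z.1 - z.2)); last first.
  apply/seteqP; split => w;
    have [to_far of_far] :=
      @not_jplus_intervalP _ _ _ A alpha gamma n w.1 w.2.1 w.2.2 n0 alpha1.
    exact: to_far.
  exact: of_far.
apply: measurableU; apply: measurable_true_set; apply: measurable_fun_ler => //;
  apply: measurable_card_set => i; apply: measurable_fun_ltr;
  by [apply: measurable_funD|apply: measurable_funB].
Qed.

Lemma jplus_miscoverageE (D : n.-tuple (X * R)) :
  jplus_miscoverage A alpha gamma D P = P (xsection miscovered D).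
Proof.
by congr (P _); apply/seteqP; split => z; rewrite /xsection/= ?inE.
Qed.

End miscoverage.

(** * Training-conditional coverage *)

Section coverage.
Context d (X : measurableType d) (R : realType).
Variables (A : regression_algorithm X R) (P : probability (X * R)%type R).
Hypothesis hmeas : measurable_algorithm A.
Hypothesis hsym : symmetric_algorithm A.
Variables (n m : nat) (alpha gamma b c e q : R).
Hypotheses (n0 : (0 < n)%N) (m0 : (0 < m)%N).
Hypotheses (alpha01 : 0 < alpha < 1) (gamma0 : 0 < gamma).
Hypotheses (betaE : beta_out A P m n.-1 = b%:E).
Hypotheses (c0 : 0 <= c) (c3 : c ^+ 3 = 2 * b / gamma) (e0 : 0 <= e).
Hypothesis qn : expR (- (2 * n%:R * e ^+ 2)) <= q.
Hypothesis qm : expR (- (2 * m%:R * e ^+ 2)) <= q.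

Let alpha1 : alpha < 1. Proof. by case/andP: alpha01. Qed.

Let M := @miscovered d X R A alpha gamma n.

Let mM : measurable M.
Proof. exact: measurable_miscovered. Qed.

Lemma miscoverage_lt_of_good_sample (w : n.-tuple (X * R) * m.-tuple (X * R)) :
  let V := cat_samples w in
  \sum_(j < m) \1_(~` M) (w.1, tnth w.2 j) <
    m%:R * (fine (P (xsection (~` M) w.1)) + e) ->
  #|rank_exceeders (pool_residual A V) (train_indices n m) (test_indices n m)
     (alpha + c)|%:R <= (alpha + c + 2 * e) * m%:R ->
  #|unstable_pairs A gamma V|%:R <= c ^+ 2 * (n * m)%:R ->
  fine (P (xsection M w.1)) < alpha + 3 * e + 2 * c.
Proof.
case: w => D D' /= test_lt exceed unst.
have mMD : measurable (xsection M D) by exact: measurable_xsection.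
have covE : fine (P (xsection (~` M) D)) = 1 - fine (P (xsection M D)).
  rewrite (_ : xsection (~` M) D = ~` xsection M D); last first.
    by apply/seteqP; split => z; rewrite /xsection/= in_setC => /negP.
  by rewrite probability_setC// fineB ?fin_num_measure.
have := card_miscovered_tests n0 alpha1 c0 unst.
have sumE : \sum_(j < m) \1_(~` M) (D, tnth D' j) =
    m%:R - #|miscovered_tests A alpha gamma D D'|%:R :> R.
  rewrite -sum1_card natr_sum [in RHS]big_mkcond/=.
  have -> : m%:R = \sum_(j < m) 1 :> R by rewrite sumr_const card_ord.
  rewrite -sumrB; apply: eq_bigr => j _.
  rewrite inE indicE in_setC; case: asboolP => [Mj|nMj].
    by rewrite mem_set// subrr.
  by rewrite memNset// subr0.
move: test_lt; rewrite sumE covE => test_lt mis_le.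
have m0' : 0 < m%:R :> R by rewrite ltr0n.
rewrite -(ltr_pM2l m0'); nra.
Qed.

(** A union bound over the two pool events and the deviation of the test points;
adjoining the test sample does not change the probability of an event on the
training sample. *)
Lemma miscoverage_prob :
  ((1 - 3 * q)%:E - c%:E <= iid_law P n
     [set D | (jplus_miscoverage A alpha gamma D P <
               (alpha + 3 * e)%:E + 2%:E * c%:E)%E])%E.
Proof.
set G := (X in iid_law P n X).
have mG : measurable G.
  rewrite /G -[X in measurable X]setTI; apply: emeasurable_fun_infty_o => //.
  rewrite (_ : (fun _ => _) = P \o xsection M); last first.
    by apply/funext => D; rewrite jplus_miscoverageE.
  exact: measurable_fun_xsection.
pose E1 := [set w : n.-tuple (X * R) * m.-tuple (X * R) |
  m%:R * (fine (P (xsection (~` M) w.1)) + e) <=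
    \sum_(j < m) \1_(~` M) (w.1, tnth w.2 j)].
pose E2 := [set V : (n + m).-tuple (X * R) |
  (alpha + c + 2 * e) * m%:R < #|rank_exceeders (pool_residual A V)
    (train_indices n m) (test_indices n m) (alpha + c)|%:R].
pose E3 := [set V : (n + m).-tuple (X * R) |
  c ^+ 2 * (n * m)%:R < #|unstable_pairs A gamma V|%:R].
have mE1 : measurable E1.
  by apply: measurable_hoeffding_event; exact: measurableC.
have mcat (E : set ((n + m).-tuple (X * R))) : measurable E ->
    measurable (@cat_samples _ _ n m @^-1` E).
  move=> mE; rewrite -[X in measurable X]setTI.
  exact: measurable_cat_samples.
have mE2 : measurable E2 by exact: measurable_exceeders_event.
have mE3 : measurable E3 by exact: measurable_unstable_event.
have PE1 : ((iid_law P n \x iid_law P m) E1 <= q%:E)%E.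
  apply: le_trans (hoeffding_conditional _ _ _ _ _) _ => //.
    exact: measurableC.
have PE2 : ((iid_law P n \x iid_law P m) (@cat_samples _ _ n m @^-1` E2)
    <= (q + q)%:E)%E.
  rewrite iid_law_cat//.
  have theta0 : 0 <= alpha + c by rewrite addr_ge0// ltW//; case/andP: alpha01.
  have := pool_exceeders_prob P hmeas hsym (train_indices n m)
    (test_indices n m) theta0 e0.
  rewrite card_train_indices card_test_indices => /le_trans; apply.
  by rewrite lee_fin lerD.
have PE3 : ((iid_law P n \x iid_law P m) (@cat_samples _ _ n m @^-1` E3)
    <= c%:E)%E.
  by rewrite iid_law_cat//; exact: unstable_pairs_prob betaE c0 c3.
have bad_sub : ~` G `*` setT `<=`
    E1 `|` (@cat_samples _ _ n m @^-1` E2 `|` @cat_samples _ _ n m @^-1` E3).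
  move=> w [nG _]; apply: contrapT => /not_orP[nE1 /not_orP[nE2 nE3]].
  apply: nG; rewrite /G/= jplus_miscoverageE.
  have mMD : measurable (xsection M w.1) by exact: measurable_xsection.
  rewrite -[ltLHS]fineK ?fin_num_measure// -EFinM -EFinD lte_fin.
  apply: miscoverage_lt_of_good_sample.
  - by rewrite ltNge; apply/negP.
  - by rewrite leNgt; apply/negP.
  - by rewrite leNgt; apply/negP.
have PnG : (iid_law P n (~` G) <= (3 * q + c)%:E)%E.
  have -> : iid_law P n (~` G) = (iid_law P n \x iid_law P m)%E (~` G `*` setT).
    transitivity (iid_law P n (~` G) * iid_law P m setT)%E.
      by rewrite probability_setT mule1.
    by apply/esym/product_measure1E => //; exact: measurableC.
  apply: le_trans (le_measure _ _ _ bad_sub) _.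
  - by rewrite inE; apply: measurableX => //; exact: measurableC.
  - by rewrite inE; apply: measurableU => //; apply: measurableU; exact: mcat.
  apply: le_trans (measureU2 _ _ _) _ => //.
    by apply: measurableU; exact: mcat.
  apply: le_trans (leeD PE1 (le_trans (measureU2 _ (mcat _ mE2) (mcat _ mE3))
    (leeD PE2 PE3))) _.
  by rewrite -!EFinD lee_fin; lra.
rewrite -[G]setCK probability_setC; last exact: measurableC.
rewrite -EFinB leeBrDr ?fin_num_measure//; last exact: measurableC.
apply: le_trans (leeD2l _ PnG) _.
by rewrite -EFinD lee_fin; lra.
Qed.

End coverage.

Theorem theorem3p2 (d : measure_display) (X : measurableType d) (R : realType)
  (alpha : R) (halpha : 0 < alpha < 1)
  (P : probability (X * R)%type R)
  (A : regression_algorithm X R)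
  (hmeas : measurable_algorithm A) (hsym : symmetric_algorithm A)
  (n : nat) (hn : (1 <= n)%N)
  (gamma : R) (hgamma : 0 < gamma)
  (m : nat) (hm : (1 <= m)%N)
  (delta : R) (hdelta : 0 < delta < 1) :
  let cbrt := poweR (2%:E * beta_out A P m n.-1 * (gamma^-1)%:E)%E 3^-1 in
  ((1 - 3 * delta)%:E - cbrt <=
   iid_law P n
     [set D : n.-tuple (X * R) |
        jplus_miscoverage A alpha gamma D P <
        (alpha + 3 * Num.sqrt (ln (1 / delta) / (2 * (minn n m)%:R)))%:E
        + 2%:E * cbrt])%E.
Proof.
cbv zeta; set cbrt := poweR _ _.
have gammaV0 : 0 < gamma^-1 by rewrite invr_gt0.
have beta0 : (0 <= beta_out A P m n.-1)%E.
  by rewrite /beta_out unlock; apply: integral_ge0 => w _; rewrite lee_fin.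
(* An infinite stability coefficient makes the lower bound -oo. *)
case betaE : (beta_out A P m n.-1) beta0 => [b| |//] beta0; last first.
  suff -> : cbrt = +oo%E by rewrite addeNy leNye.
  rewrite /cbrt betaE gt0_muley ?lte_fin// gt0_mulye ?lte_fin//.
  by rewrite poweRyr// invr_eq0.
rewrite lee_fin in beta0.
set e := Num.sqrt _.
have x0 : 0 <= 2 * b / gamma by rewrite mulr_ge0 ?mulr_ge0// ltW.
pose c := (2 * b / gamma) `^ 3^-1.
have cbrtE : cbrt = c%:E by rewrite /cbrt betaE -!EFinM poweR_EFin.
have c3 : c ^+ 3 = 2 * b / gamma.
  by rewrite -powR_mulrn ?powR_ge0// -powRrM mulVf// powRr1.
have delta0 : 0 < delta by case/andP: hdelta.
have log0 : 0 <= ln (1 / delta).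
  rewrite ln_ge0// ler_pdivlMr// mul1r ltW//; by case/andP: hdelta.
have tail_le k : (minn n m <= k)%N -> expR (- (2 * k%:R * e ^+ 2)) <= delta.
  move=> mk; have min0 : 0 < (minn n m)%:R :> R by rewrite ltr0n leq_min hn hm.
  rewrite /e sqr_sqrtr ?divr_ge0// -[leRHS]lnK ?posrE// ler_expR lerNl.
  rewrite (_ : - ln delta = ln (1 / delta)); last by rewrite div1r lnV.
  rewrite mulrCA ler_peMr//.
  by rewrite ler_pdivlMr ?mulr_gt0// mul1r ler_pM2l// ler_nat.
rewrite cbrtE.
apply: (miscoverage_prob hmeas hsym hn hm halpha hgamma betaE _ c3) => //.
- exact: powR_ge0.
- exact: sqrtr_ge0.
- by apply: tail_le; rewrite geq_minl.
- by apply: tail_le; rewrite geq_minr.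
Qed.
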